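(* For any graph $G$ we have $\operatorname{pn}_\ell(G) \leq \operatorname{sa}_\ell(G)$ and $\operatorname{pn}_u(G) \leq \operatorname{sa}(G)$. In particular, \[ \frac{\operatorname{mad}(G)}{4} \leq \operatorname{pn}_\ell(G) \leq \frac{\operatorname{mad}(G)}{2}+2 \quad \text{ and } \quad \frac{\operatorname{mad}(G)}{4} \leq \operatorname{pn}_u(G) \leq \operatorname{mad}(G)+2. \]
   Context: All graphs are finite and simple (with at least one edge where quantities require it). A linear embedding of $G=(V,E)$ is a pair $(\prec,\mathcal{P})$ where $\prec$ is a total ordering of $V$ and $\mathcal{P}$ is a partition of $E$ into parts called pages. Two edges $uv, xy$ with $u\prec v$, $x \prec y$ cross if $u \prec x \prec v \prec y$ or $x \prec u \prec y \prec v$. A book embedding is a linear embedding in which no two crossing edges lie on the same page. For a book embedding and vertex $v$, $\mathcal{P}_v$ is the set of pages containing an edge incident to $v$; the embedding is $k$-local if $|\mathcal{P}_v|\le k$ for all $v$; $\operatorname{pn}_\ell(G)$ is the smallest $k$ such that $G$ admits a $k$-local book embedding. For a page $P$, $G_P$ is the subgraph formed by the edges of $P$ and the vertices incident to them. A union embedding is a linear embedding such that for every page $P$ and every connected component $C$ of $G_P$, no two edges of $C$ cross; $\operatorname{pn}_u(G)$ is the smallest number of pages of a union embedding of $G$. The maximum average degree is $\operatorname{mad}(G) = \max\{2|E(H)|/|V(H)| : H \subseteq G, H \ne \emptyset\}$. The star arboricity $\operatorname{sa}(G)$ is the minimum $k$ such that $E(G)$ can be partitioned into $k$ star forests (forests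 each of whose components is a star). The local star arboricity $\operatorname{sa}_\ell(G)$ is the minimum $k$ such that $E(G)$ can be partitioned into some number of stars with each vertex incident to edges of at most $k$ of these stars. *)

(* Defs.v *)
From HB Require Import structures.
From mathcomp Require Import all_boot all_order all_algebra.
From mathcomp Require Import boolp zify.
Set Implicit Arguments. Unset Strict Implicit. Unset Printing Implicit Defensive.
Import Order.TTheory GRing.Theory Num.Theory.

(* A graph is a rel [e] on a finType [T] (the theorem assumes it symmetric
   and irreflexive, i.e. a finite simple graph). *)
Section GraphDefs.
Variables (T : finType) (e : rel T).

Definition edges : {set {set T}} :=
  [set f : {set T} | [exists u : T, exists v : T, e u v && (f == [set u; v])]].

Definition edge_t : finType := {f : {set T} | f \in edges}.

(* A total ordering of V is given by an injective position map o : T -> nat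
   (u precedes v iff o u < o v).  Edges f, g cross. *)
Definition cross (o : T -> nat) (f g : {set T}) : Prop :=
  exists u v x y, [/\ u \in f, v \in f, x \in g & y \in g] /\
    ((o u < o x /\ o x < o v /\ o v < o y) \/
     (o x < o u /\ o u < o y /\ o y < o v)).

(* Pages of a linear embedding: a labelling p of the edges; the pages are the
   nonempty fibres of p. *)
Definition book_embedding (L : eqType) (o : T -> nat) (p : edge_t -> L) : Prop :=
  injective o /\ forall f g : edge_t, p f = p g -> ~ cross o (val f) (val g).

Definition page_adj (L : eqType) (p : edge_t -> L) (i : L) : rel T :=
  fun x y => [exists f : edge_t, (p f == i) && (val f == [set x; y])].

Definition same_page_comp (L : eqType) (p : edge_t -> L) (f g : edge_t) : Prop :=
  p f = p g /\ exists u x, [/\ u \in val f, x \in val g & connect (page_adj p (p f)) u x].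

Definition union_embedding (L : eqType) (o : T -> nat) (p : edge_t -> L) : Prop :=
  injective o /\ forall f g : edge_t, same_page_comp p f g -> ~ cross o (val f) (val g).

(* G has a k-local book embedding (at most #|E| pages suffice for any partition) *)
Definition local_book_embeddable (k : nat) : Prop :=
  exists (o : T -> nat) (p : edge_t -> 'I_#|{: edge_t}|),
    book_embedding o p /\
    forall v : T, #|[set p f | f : edge_t & v \in val f]| <= k.

Definition union_embeddable (k : nat) : Prop :=
  exists (o : T -> nat) (p : edge_t -> 'I_k), union_embedding o p.

Definition same_comp (F : {set {set T}}) (f g : {set T}) : Prop :=
  exists u x, [/\ u \in f, x \in g & connect (fun a b => [set a; b] \in F) u x].

Definition star_forest (F : {set {set T}}) : Prop :=
  forall f, f \in F -> exists z : T, forall g, g \in F -> same_comp F f g -> z \in g.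

Definition star_arb_le (k : nat) : Prop :=
  exists c : edge_t -> 'I_k,
    forall i : 'I_k, star_forest [set val f | f : edge_t & c f == i].

Definition local_star_arb_le (k : nat) : Prop :=
  exists s : edge_t -> 'I_#|{: edge_t}|,
    (forall f : edge_t, exists z : T, forall g : edge_t, s g = s f -> z \in val g) /\
    forall v : T, #|[set s f | f : edge_t & v \in val f]| <= k.

(* ---- existence (each edge on its own page / in its own star) ---- *)
Lemma edge_no_self_cross (o : T -> nat) (f : edge_t) : ~ cross o (val f) (val f).
Proof.
case: f => /= f; rewrite inE => /existsP [a /existsP [b /andP [_ /eqP ->]]] [u [v [x [y [[hu hv hx hy] H]]]]].
move: hu hv hx hy H; rewrite !inE.
by do 4 (case/orP => /eqP ->); case=> [[h1 [h2 h3]]|[h1 [h2 h3]]]; lia.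
Qed.

Let o0 : T -> nat := fun x => val (enum_rank x).
Let o0_inj : injective o0.
Proof. by move=> x y /val_inj /enum_rank_inj. Qed.

Lemma ex_local_book : exists k, `[< local_book_embeddable k >].
Proof.
exists #|{: edge_t}|; apply/asboolT; exists o0, (@enum_rank edge_t); split.
  split=> // f g /enum_rank_inj ->; exact: edge_no_self_cross.
by move=> v; rewrite -[X in _ <= X]card_ord max_card.
Qed.

Lemma ex_union : exists k, `[< union_embeddable k >].
Proof.
exists #|{: edge_t}|; apply/asboolT; exists o0, (@enum_rank edge_t); split=> //.
move=> f g [/enum_rank_inj -> _]; exact: edge_no_self_cross.
Qed.

Lemma edge_elem (f : edge_t) : exists z, z \in val f.
Proof.
by case: f => /= f; rewrite inE => /existsP [a /existsP [b /andP [_ /eqP ->]]];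
   exists a; rewrite !inE eqxx.
Qed.

Lemma ex_star_arb : exists k, `[< star_arb_le k >].
Proof.
exists #|{: edge_t}|; apply/asboolT; exists (@enum_rank edge_t) => i f.
case/imsetP => f0; rewrite inE => /eqP h0 ->.
have [z hz] := edge_elem f0; exists z => g /imsetP [g0]; rewrite inE => /eqP h1 -> _.
by rewrite (enum_rank_inj (etrans h1 (esym h0))).
Qed.

Lemma ex_local_star_arb : exists k, `[< local_star_arb_le k >].
Proof.
exists #|{: edge_t}|; apply/asboolT; exists (@enum_rank edge_t); split.
  move=> f; have [z hz] := edge_elem f; exists z => g /enum_rank_inj -> //.
by move=> v; rewrite -[X in _ <= X]card_ord max_card.
Qed.

Definition pn_local : nat := ex_minn ex_local_book.
Definition pn_union : nat := ex_minn ex_union.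
Definition star_arboricity : nat := ex_minn ex_star_arb.
Definition local_star_arboricity : nat := ex_minn ex_local_star_arb.

Definition mad : rat :=
  \big[Num.max/0%R]_(S : {set T} | S != set0)
    \big[Num.max/0%R]_(F : {set {set T}} | (F \subset edges) &&
                                            [forall f in F, f \subset S])
      ((2 * #|F|)%:R / #|S|%:R)%R.

End GraphDefs.

(* Main.v *)
Require Import Defs.
From HB Require Import structures.
From mathcomp Require Import all_boot all_order all_algebra.
From mathcomp Require Import boolp zify lra.
Import Order.TTheory GRing.Theory Num.Theory.

Set Implicit Arguments.
Unset Strict Implicit.
Unset Printing Implicit Defensive.

(* Upper bounds by star arboricities: edges of one star pairwise share a vertex,
   so they never cross, whatever the vertex ordering is.

   Lower bounds: on a page, an edge uv (u before v) is the longest edge going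
   right from u or the longest one going left from v, since otherwise the two
   longer edges cross and both meet uv.  Charging the edge to (u, page) or to
   (v, page) gives |F| <= 2 k |S| for every set F of edges inside S.

   Upper bound for pn_local: if k > mad / 2 then G has an orientation with all
   outdegrees at most k, and the in-edges of each vertex form a star; every vertex
   meets at most k + 1 of these stars.

   Upper bound for pn_union: if k + 1 > (mad + 1) / 2 then G splits into k + 1
   forests.  Splitting all of them into two star forests would use 2 k + 2
   pages, one too many; instead the vertex ordering is chosen so that one of
   the forests has no crossing at all, and 2 k + 1 <= mad + 2 pages suffice.

   Both the orientation (Hakimi) and the forests (Nash-Williams) come from one
   exchange argument for matroid partition, with matroids given by their
   closure operators. *)

(** * Matroid partition from closure operators *)

Section MatroidPartition.
Variables (E I : finType) (cl : I -> {set E} -> pred E).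
Hypothesis cl_ext : forall i (A : {set E}) f, f \in A -> cl i A f.
Hypothesis cl_trans : forall i (A B : {set E}) f,
  (forall a, a \in A -> cl i B a) -> cl i A f -> cl i B f.
Hypothesis cl_exch : forall i (A : {set E}) e f,
  cl i (f |: A) e -> ~~ cl i A e -> cl i (e |: A) f.

Definition indep i (A : {set E}) := forall f, f \in A -> ~~ cl i (A :\ f) f.

Lemma cl_mono i (A B : {set E}) f : A \subset B -> cl i A f -> cl i B f.
Proof. by move/subsetP=> AB; apply: cl_trans => a /AB /cl_ext. Qed.

Lemma indepS i (A B : {set E}) : A \subset B -> indep i B -> indep i A.
Proof.
move=> AB iB f fA; apply: contra (iB f (subsetP AB _ fA)).
exact/cl_mono/setSD.
Qed.

Lemma indepU1 i (A : {set E}) e : indep i A -> ~~ cl i A e -> indep i (e |: A).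
Proof.
move=> iA neA; have eA : e \notin A by apply: contra neA; apply: cl_ext.
move=> f; have [-> _|nfe] := eqVneq f e; first by rewrite setU1K.
rewrite !inE (negbTE nfe) => /= fA; apply/negP.
have -> : (e |: A) :\ f = e |: (A :\ f).
  by apply/setP=> x; rewrite !inE; case: eqVneq => [->|//]; rewrite (negbTE nfe).
by move=> /cl_exch /(_ (iA f fA)); rewrite setD1K // => /(negP neA).
Qed.

(** Take an inclusion-minimal [B] inside [A] that spans [e]. If some [f] in [B] lies outside [S],
    then [A :\ f] spans [e]. By minimality and exchange, [e] and [B :\ f] span [f], hence so does
    [A :\ f], against independence. *)
Lemma spanned_by_swappable i (A S : {set E}) e : indep i A -> cl i A e ->
  (forall f, f \in A -> f \notin S -> cl i (A :\ f) e) -> cl i (A :&: S) e.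
Proof.
move=> iA eA swap.
have: exists B : {set E}, (B \subset A) && cl i B e by exists A; rewrite subxx.
case/(ex_minset (P := fun B : {set E} => (B \subset A) && cl i B e)) => B /minsetP.
move=> [/andP[BA eB] minB]; apply: (cl_mono _ eB).
apply/subsetP=> f fB; have fA := subsetP BA _ fB; rewrite inE fA /=.
apply: contraT => fS; have eAf := swap f fA fS.
have : ~~ cl i (B :\ f) e.
  apply/negP=> eBf; have := minB (B :\ f).
  rewrite (subset_trans (subsetDl _ _) BA) eBf subsetDl => /(_ isT isT).
  by move/setP/(_ f); rewrite !inE eqxx fB.
move=> neBf; have := cl_exch (A := B :\ f) (e := e) (f := f) (i := i).
rewrite setD1K // => /(_ eB neBf) fe.
case/negP: (iA f fA); apply: cl_trans fe => a; rewrite !inE.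
by case/orP=> [/eqP->//|/andP[af aB]]; apply: cl_ext; rewrite !inE af (subsetP BA).
Qed.

Implicit Types c : {ffun E -> option I}.

Definition cls c i : {set E} := [set f | c f == Some i].
Definition indep_col c := forall i, indep i (cls c i).
Definition unassigned c : {set E} := [set f | c f == None].
Definition upd c f (o : option I) : {ffun E -> option I} :=
  [ffun g => if g == f then o else c g].

(** Each swap is tested against the current colouring, so independence is preserved step by step.
    This replaces the choice of a shortest augmenting path. *)
Inductive reach c0 e0 : {ffun E -> option I} -> E -> Prop :=
| reach_refl : reach c0 e0 c0 e0
| reach_swap c e f i : reach c0 e0 c e -> c f = Some i ->
    ~~ cl i (cls c i :\ f) e -> reach c0 e0 (upd (upd c f None) e (Some i)) f.

Lemma cls_upd_Some c e i j : c e = None ->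
  cls (upd c e (Some i)) j = if j == i then e |: cls c i else cls c j.
Proof.
move=> ce; apply/setP=> g; have [->|ge] := eqVneq g e.
  rewrite !inE ffunE eqxx (inj_eq Some_inj) eq_sym.
  by case: (eqVneq j i); rewrite !inE ?eqxx // ce.
by case: (eqVneq j i) => [->|_]; rewrite !inE ffunE (negbTE ge).
Qed.

Lemma cls_upd_None c f j : cls (upd c f None) j = cls c j :\ f.
Proof. by apply/setP=> g; rewrite !inE ffunE; case: (eqVneq g f). Qed.

(* Exchanges along [reach] move a single unassigned element around.  If no
   sequence of exchanges ends in an augmentation, the set [S] of elements that
   can become unassigned is spanned, for every [i], by its part of colour [i]. *)
Lemma matroid_partition :
  (exists c : E -> I, forall i, indep i [set f | c f == i]) \/
  (exists c (S : {set E}) e, [/\ e \in S, c e = None &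
     forall i f, f \in S -> cl i (cls c i :&: S) f]).
Proof.
have [c0 ic0 minc0] : exists2 c0, indep_col c0 &
    forall c, indep_col c -> #|unassigned c0| <= #|unassigned c|.
  pose P n := `[< exists2 c, indep_col c & #|unassigned c| = n >].
  have: exists n, P n.
    exists #|unassigned [ffun=> None]|; apply/asboolP; exists [ffun=> None] => //.
    by move=> i f; rewrite inE ffunE.
  case/ex_minnP=> n /asboolP[c ic <-] mn; exists c => // c' ic'.
  by apply: mn; apply/asboolP; exists c'.
have [/set0Pn[e0]|] := boolP (unassigned c0 != set0); last first.
  rewrite negbK => /eqP full; left.
  have tot f : exists i, c0 f = Some i.
    case E0: (c0 f) => [i|]; first by exists i.
    by have: f \in unassigned c0; [rewrite inE E0|rewrite full inE].
  have [c cP] := choice tot; exists c => i.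
  have -> : [set f | c f == i] = cls c0 i by apply/setP=> f; rewrite !inE cP.
  exact: ic0.
rewrite inE => /eqP c0e0; right.
pose S := [set f | `[< exists c, reach c0 e0 c f >]].
(* Otherwise [e] could take colour [i], leaving fewer unassigned elements than the minimum. *)
have maxi c e i : indep_col c -> c e = None -> #|unassigned c| = #|unassigned c0| ->
    cl i (cls c i) e.
  move=> ic ce nc; apply: contraT => ne.
  have ic' : indep_col (upd c e (Some i)).
    by move=> j; rewrite cls_upd_Some //; case: (eqVneq j i) => [->|_ //]; apply: indepU1.
  have := minc0 _ ic'; rewrite -nc leqNgt.
  have -> : unassigned (upd c e (Some i)) = unassigned c :\ e.
    by apply/setP=> g; rewrite !inE !ffunE; case: (eqVneq g e).
  by rewrite [#|unassigned c|](cardsD1 e) inE ce eqxx ltnS leqnn.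
have spanS c e i : reach c0 e0 c e -> indep_col c -> c e = None ->
    #|unassigned c| = #|unassigned c0| -> cl i (cls c i :&: S) e.
  move=> rc ic ce nc; apply: spanned_by_swappable => //; first exact: maxi.
  move=> f; rewrite !inE => /eqP cf; apply: contraR => ne.
  by apply/asboolP; exists (upd (upd c f None) e (Some i)); apply: reach_swap.
(* The last clause carries spans back to [c0]: a swap adds only [e] to a class, and that class cut
   with [S] already spanned [e]. *)
have inv c e : reach c0 e0 c e -> [/\ indep_col c, c e = None,
    #|unassigned c| = #|unassigned c0| &
    forall i f, cl i (cls c i :&: S) f -> cl i (cls c0 i :&: S) f].
  elim=> // {}c {}e f i rc [ic ce nc sub] cf ne.
  have ef : e != f by apply/eqP=> ef; rewrite ef cf in ce.
  have ce' : upd c f None e = None by rewrite ffunE (negbTE ef).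
  have fS : f \in S.
    by rewrite inE; apply/asboolP; exists (upd (upd c f None) e (Some i)); apply: reach_swap.
  have eS : cl i (cls c i :&: S) e by apply: spanS.
  split.
  - move=> j; rewrite cls_upd_Some // !cls_upd_None; case: (eqVneq j i) => [->|_].
      by apply: indepU1 => //; apply: indepS (ic i); apply: subsetDl.
    by apply: indepS (ic j); apply: subsetDl.
  - by rewrite !ffunE eq_sym (negbTE ef) eqxx.
  - rewrite -nc; have -> : unassigned (upd (upd c f None) e (Some i)) = f |: (unassigned c :\ e).
      apply/setP=> g; rewrite !inE !ffunE; have [->|ge] := eqVneq g e.
        by rewrite (negbTE ef).
      by case: (eqVneq g f).
    rewrite cardsU1 [RHS](cardsD1 e) !inE ce cf eqxx andbF; lia.
  - move=> j g H; apply: sub; apply: cl_trans H => a.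
    rewrite inE cls_upd_Some // !cls_upd_None; case: (eqVneq j i) => [->|_] /andP[].
      rewrite !inE => /orP[/eqP-> _ //|/andP[_ ca] aS].
      by apply: cl_ext; rewrite !inE ca.
    by rewrite !inE => /andP[_ ca] aS; apply: cl_ext; rewrite !inE ca.
exists c0, S, e0; split=> //.
  by rewrite inE; apply/asboolP; exists c0; apply: reach_refl.
move=> i f; rewrite inE => /asboolP[c rc]; have [ic cf nc sub] := inv _ _ rc.
by apply: sub; apply: spanS.
Qed.

End MatroidPartition.

(** * Edges, crossings and the maximum average degree *)

Section Graph.
Variables (T : finType) (e : rel T).
Hypothesis e_irr : irreflexive e.
Implicit Types (f g h : edge_t e) (o : T -> nat).

Lemma edgeP f : exists u v, u != v /\ val f = [set u; v].
Proof.
have := valP f; rewrite inE => /existsP[u /existsP[v /andP[euv /eqP->]]].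
by exists u, v; split=> //; apply: contraTneq euv => ->; rewrite e_irr.
Qed.

Lemma edge_ends f u v : u \in val f -> v \in val f -> u != v ->
  val f = [set u; v].
Proof.
have [a [b [_ ->]]] := edgeP f; rewrite !inE.
case/orP=> /eqP-> /orP[]/eqP->; rewrite ?eqxx // => _.
by rewrite setUC.
Qed.

Lemma edge_other f u : u \in val f -> exists2 v, u != v & val f = [set u; v].
Proof.
have [a [b [nab ->]]] := edgeP f; rewrite !inE => /orP[]/eqP->; first by exists b.
by exists a; rewrite 1?eq_sym // setUC.
Qed.

(** The four endpoints of a crossing occupy distinct positions, but two edges with a common vertex
    have at most three endpoints. *)
Lemma common_vertex_not_cross o f g z : z \in val f -> z \in val g ->
  ~ cross o (val f) (val g).
Proof.
move=> zf zg [u [v [x [y [[uf vf xg yg] uvxy]]]]].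
have uv : u != v by apply/eqP=> uv; subst; lia.
have xy : x != y by apply/eqP=> xy; subst; lia.
move: zf zg; rewrite (edge_ends uf vf uv) (edge_ends xg yg xy) !inE.
by case/orP=> /eqP-> /orP[]/eqP H; subst; lia.
Qed.

Lemma mad_ge0 : (0 <= mad e)%R.
Proof. by apply: bigmax_ge_id. Qed.

Lemma card_edges_mad (S : {set T}) (F : {set edge_t e}) :
  (forall f, f \in F -> val f \subset S) ->
  ((2 * #|F|)%:R <= mad e * #|S|%:R)%R.
Proof.
move=> FS; have [S0|S0] := eqVneq S set0.
  have -> : F = set0.
    apply/setP=> f; rewrite inE; apply/negP=> /FS.
    have [u [v [_ ->]]] := edgeP f; rewrite S0 subset0 => /eqP/setP/(_ u).
    by rewrite !inE eqxx.
  by rewrite S0 !cards0 muln0 mulr0.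
rewrite -ler_pdivrMr ?ltr0n ?card_gt0 // -(card_imset F val_inj).
have : (mad e <= mad e)%R by [].
rewrite {1}/mad => /bigmax_leP[_ /(_ S S0) /bigmax_leP[_]]; apply.
apply/andP; split; first by apply/subsetP=> _ /imsetP[f _ ->]; apply: valP.
by apply/forallP=> x; apply/implyP=> /imsetP[f /FS fS ->].
Qed.

Lemma mad_le (K : nat) :
  (forall (S : {set T}) (F : {set edge_t e}),
    (forall f, f \in F -> val f \subset S) -> 2 * #|F| <= K * #|S|) ->
  (mad e <= K%:R)%R.
Proof.
move=> H; apply/bigmax_leP; split=> // S S0.
apply/bigmax_leP; split=> // F /andP[Fe /forallP FS].
rewrite ler_pdivrMr ?ltr0n ?card_gt0 // -natrM ler_nat.
have -> : F = val @: [set f : edge_t e | val f \in F].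
  apply/setP=> x; apply/idP/imsetP=> [xF|[f + ->]]; last by rewrite inE.
  by exists (Sub x (subsetP Fe _ xF)); rewrite ?inE SubK.
rewrite (card_imset _ val_inj); apply: H => f; rewrite inE => fF.
by have := FS (val f); rewrite fF.
Qed.

(** * Lower bounds by charging extremal edges *)

Section LowerBound.
Variables (L : finType) (o : T -> nat) (p : edge_t e -> L) (K : nat).
Hypothesis o_inj : injective o.
(** Common to book and union embeddings: [f] and [g] both meet [h] on one page, hence lie in one
    component of it. *)
Hypothesis p_nocross : forall f g h z w, p f = p h -> p g = p h ->
  z \in val f -> z \in val h -> w \in val g -> w \in val h ->
  ~ cross o (val f) (val g).
Hypothesis p_local : forall v, #|[set p f | f : edge_t e & v \in val f]| <= K.

(** An extremal edge [f] is charged to ([a f], [p f]). By antisymmetry two extremal edges with the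
    same charge also agree in [b], and each vertex of [S] meets at most [K] pages. The uses are
    [leq] with left ends as [a], and [geq] with right ends. *)
Lemma card_extremal_edges (le : rel nat) (a b : edge_t e -> T)
    (S : {set T}) (F : {set edge_t e}) :
  antisymmetric le -> (forall f, val f = [set a f; b f]) ->
  (forall f, f \in F -> val f \subset S) ->
  #|[set f in F | [forall g in F, (p g == p f) && (a g == a f) ==>
                                  le (o (b g)) (o (b f))]]| <= K * #|S|.
Proof.
move=> le_anti ab FS; set X := [set f in F | _].
pose D := [set vi : T * L | (vi.1 \in S) &&
             (vi.2 \in [set p f | f : edge_t e & vi.1 \in val f])].
have injX : {in X &, injective (fun f => (a f, p f))}.
  move=> f g; rewrite !inE => /andP[fF /forall_inP mf] /andP[gF /forall_inP mg] [afg pfg].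
  have /implyP := mf g gF; rewrite afg pfg !eqxx => /(_ isT) h1.
  have /implyP := mg f fF; rewrite afg pfg !eqxx => /(_ isT) h2.
  have bfg : b f = b g by apply: o_inj; apply: le_anti; rewrite h1 h2.
  by apply: val_inj; rewrite !ab afg bfg.
rewrite -(card_in_imset injX).
apply: leq_trans (_ : #|D| <= _).
  apply/subset_leq_card/subsetP=> _ /imsetP[f fX ->].
  have afv : a f \in val f by rewrite ab !inE eqxx.
  have fF : f \in F by move: fX; rewrite inE => /andP[].
  rewrite inE /= (subsetP (FS f fF)) //=.
  by apply/imsetP; exists f; rewrite ?inE.
rewrite -sum1_card (eq_bigl (fun vi => (vi.1 \in S) &&
   (vi.2 \in [set p f | f : edge_t e & vi.1 \in val f]))); last by move=> vi; rewrite inE.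
rewrite -(pair_big_dep (fun v => v \in S)
   (fun v i => i \in [set p f | f : edge_t e & v \in val f]) (fun _ _ => 1)) /=.
rewrite mulnC -sum_nat_const; apply: leq_sum => v _.
by rewrite sum1_card.
Qed.

Lemma mad_le_4K : (mad e <= (4 * K)%:R)%R.
Proof.
apply: mad_le => S F FS.
have ends f : exists uv : T * T, o uv.1 < o uv.2 /\ val f = [set uv.1; uv.2].
  have [u [v [uv ->]]] := edgeP f.
  case: (ltngtP (o u) (o v)) => [lt|gt|/o_inj eq]; first by exists (u, v).
    by exists (v, u); split=> //; rewrite setUC.
  by rewrite eq eqxx in uv.
have [lr lrP] := choice ends.
pose l f := (lr f).1; pose r f := (lr f).2.
have lrE f : val f = [set l f; r f] by case: (lrP f).
have rlE f : val f = [set r f; l f] by rewrite setUC.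
have ltlr f : o (l f) < o (r f) by case: (lrP f).
have leP : antisymmetric leq by move=> x y; rewrite -eqn_leq => /eqP.
have geP : antisymmetric geq by move=> x y; rewrite /= -eqn_leq => /eqP.
have := card_extremal_edges leP lrE FS; set A := [set f in F | _] => cA.
have := card_extremal_edges geP rlE FS; set B := [set f in F | _] => cB.
suff FAB : F \subset A :|: B.
  have := subset_leq_card FAB; have := cardsUI A B; nia.
(* If [h] is extremal on neither side, some [f] starts at [l h] and ends beyond [r h], and some [g]
   ends at [r h] and starts before [l h]; these two cross. *)
apply/subsetP=> h hF; rewrite !inE hF /=; apply: contraT.
rewrite negb_or !negb_forall_in => /andP[/exists_inP[f fF] + /exists_inP[g gF]].
rewrite !negb_imply -!ltnNge => /andP[/andP[/eqP pf /eqP lf] rf] /andP[/andP[/eqP pg /eqP rg] lg].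
case: (@p_nocross g f h (r h) (l h)) => //; rewrite ?lrE ?inE ?eqxx ?orbT -?lf -?rg ?eqxx ?orbT //.
exists (l g), (r g), (l f), (r f); rewrite !inE !eqxx !orbT; split=> //.
by left; rewrite lf rg ltlr.
Qed.

End LowerBound.

Lemma mad_le_pn_local : (mad e <= (4 * pn_local e)%:R)%R.
Proof.
rewrite /pn_local; case: ex_minnP => k /asboolP[o [p [[o_inj bk] lk]]] _.
apply: (mad_le_4K o_inj _ lk) => f g h z w pf pg _ _ _ _.
by apply: bk; rewrite pf pg.
Qed.

Lemma mad_le_pn_union : (mad e <= (4 * pn_union e)%:R)%R.
Proof.
rewrite /pn_union; case: ex_minnP => k /asboolP[o [p [o_inj uk]]] _.
apply: (mad_le_4K o_inj (p := p)); last first.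
  by move=> v; rewrite -[X in _ <= X]card_ord max_card.
move=> f g h z w pf pg zf zh wg wh; apply: uk; split; first by rewrite pf pg.
exists z, w; split=> //; have [->|zw] := eqVneq z w; first exact: connect0.
by apply/connect1/existsP; exists h; rewrite pf eqxx (edge_ends zh wh zw) eqxx.
Qed.

(** * Upper bounds by star arboricities *)

Lemma star_color_book (s : edge_t e -> 'I_#|{: edge_t e}|) k :
  (forall f, exists z, forall g, s g = s f -> z \in val g) ->
  (forall v, #|[set s f | f : edge_t e & v \in val f]| <= k) ->
  local_book_embeddable e k.
Proof.
move=> sstar sk; exists (fun x => val (enum_rank x)), s; split=> //; split.
  by move=> x y /val_inj /enum_rank_inj.
move=> f g fg; have [z zP] := sstar f.
by apply: (@common_vertex_not_cross _ _ _ z); apply: zP.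
Qed.

Lemma pn_local_le_sa : pn_local e <= local_star_arboricity e.
Proof.
rewrite /local_star_arboricity; case: ex_minnP => k /asboolP[s [s1 s2]] _.
rewrite /pn_local; case: ex_minnP => m _; apply; apply/asboolP.
exact: star_color_book s1 s2.
Qed.

Lemma pn_union_le_sa : pn_union e <= star_arboricity e.
Proof.
rewrite /star_arboricity; case: ex_minnP => k /asboolP[c cP] _.
rewrite /pn_union; case: ex_minnP => m _; apply; apply/asboolP.
exists (fun x => val (enum_rank x)), c; split.
  by move=> x y /val_inj /enum_rank_inj.
move=> f g [cfg [u [x [uf xg ux]]]].
set F := [set val f' | f' : edge_t e & c f' == c f].
have inF h : c h = c f -> val h \in F by move=> hf; apply/imsetP; exists h; rewrite ?inE ?hf.
have [z zP] := cP (c f) (val f) (inF f erefl).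
apply: (@common_vertex_not_cross _ _ _ z); apply: zP; rewrite ?inF //.
  by exists u, u; split=> //; apply: connect0.
exists u, x; split=> //; apply: connect_sub ux => a b /existsP[h /andP[/eqP hf /eqP hab]].
by apply: connect1; rewrite -hab inF.
Qed.

(** * Bounded orientations and local book embeddings *)

(* Rank-one matroids: for each vertex [v] and [i < k], an independent set is at
   most one edge at [v].  Partitioning into them orients [G] with outdegrees at
   most [k]; edges away from [v] are loops. *)
Definition star_span k (vi : T * 'I_k) (A : {set edge_t e}) : pred (edge_t e) :=
  fun f => (vi.1 \in val f) ==> [exists a in A, vi.1 \in val a].

Lemma bounded_orientation k : (mad e < (2 * k)%:R)%R ->
  exists t : edge_t e -> T, (forall f, t f \in val f) /\
    forall v, #|[set f | t f == v]| <= k.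
Proof.
move=> mk; have [||| [c cI]|[c [S [x [xS cx cS]]]]] := @matroid_partition _ _ (@star_span k).
- by move=> i A f fA; apply/implyP=> vf; apply/exists_inP; exists f.
- move=> i A B f AB /implyP Af; apply/implyP=> /Af/exists_inP[a /AB /implyP Ba va].
  exact: Ba.
- move=> i A f g /implyP Af; rewrite negb_imply => /andP[vf nA]; apply/implyP=> vg.
  by apply/exists_inP; exists f; rewrite ?setU11.
- have cv f : (c f).1 \in val f.
    by have := cI (c f) f; rewrite inE eqxx => /(_ isT); rewrite negb_imply => /andP[].
  exists (fun f => (c f).1); split=> // v.
  have inj : {in [set f | (c f).1 == v] &, injective (fun f => (c f).2)}.
    move=> f g; rewrite !inE => /eqP fv /eqP gv cfg2.
    have cfg : c g = c f by rewrite [c f]surjective_pairing fv -gv cfg2 -surjective_pairing.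
    have := cI (c f) f; rewrite inE eqxx negb_imply => /(_ isT)/andP[_].
    rewrite negb_exists_in => /forall_inP/(_ g) H; apply/eqP; apply: contraT => nfg.
    by move: H; rewrite !inE cfg eqxx eq_sym nfg -cfg cv => /(_ isT).
  by rewrite -(card_in_imset inj) -[X in _ <= X]card_ord max_card.
(* The obstruction is too dense: each pair of a vertex in [V] and an index below [k] is the colour
   of some edge of [S], and [x] is uncoloured, so more than [k * #|V|] edges lie inside [V]. *)
pose V := [set v | [exists f in S, v \in val f]].
have SV : forall f, f \in S -> val f \subset V.
  by move=> f fS; apply/subsetP=> v vf; rewrite inE; apply/exists_inP; exists f.
have : k * #|V| < #|S|.
  rewrite (cardsD1 x) xS ltnS; apply: leq_trans (leq_imset_card c _).
  rewrite -[k in k * _]card_ord -cardsT mulnC -cardsX -(card_imset _ Some_inj).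
  apply/subset_leq_card/subsetP=> _ /imsetP[[v i] + ->].
  rewrite !inE /= andbT => /exists_inP[f fS vf].
  have /implyP/(_ vf)/exists_inP[g] := cS (v, i) f fS.
  rewrite !inE => /andP[/eqP cg gS] _; apply/imsetP; exists g; rewrite // !inE gS andbT.
  by apply/eqP=> gx; rewrite gx cx in cg.
have H1 := card_edges_mad SV; move=> H2.
have : ((2 * #|S|)%:R <= (2 * k)%:R * #|V|%:R :> rat)%R.
  by apply: le_trans H1 _; apply: ler_wpM2r; rewrite ?ler0n // ltW.
by rewrite -natrM ler_nat; lia.
Qed.

(** Stars come labelled by vertices, while page labels range over an ordinal of size the number of
    edges. Each label in use is replaced by the rank of one edge carrying it. *)
Lemma edge_relabel (L : finType) (lab : edge_t e -> L) :
  exists s : edge_t e -> 'I_#|{: edge_t e}|,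
    (forall f g, s f = s g -> lab f = lab g) /\
    forall A : pred (edge_t e),
      #|[set s f | f : edge_t e & A f]| <= #|[set lab f | f : edge_t e & A f]|.
Proof.
pose r l := [pick g | lab g == l].
have rP f : exists2 g, r (lab f) = Some g & lab g = lab f.
  by rewrite /r; case: pickP => [g /eqP|/(_ f)]; [exists g | rewrite eqxx].
pose s f := enum_rank (odflt f (r (lab f))).
have sP f : Some (enum_val (s f)) = r (lab f).
  by have [g rg _] := rP f; rewrite /s enum_rankK rg.
exists s; split=> [f g sfg|A].
  have := sP f; rewrite sfg sP; have [f' -> <-] := rP f; have [g' -> <-] := rP g.
  by case=> ->.
rewrite -(card_imset _ (inj_comp Some_inj enum_val_inj)) -imset_comp.
by rewrite (eq_imset _ sP) (imset_comp r lab) leq_imset_card.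
Qed.

Lemma local_book_of_mad k : (mad e < (2 * k)%:R)%R -> local_book_embeddable e k.+1.
Proof.
case/bounded_orientation=> t [tf tk].
have [hd hdP] := choice (fun f => let: ex_intro2 v nv fv := edge_other (tf f) in
  ex_intro (fun v => val f = [set t f; v]) v fv).
have [s [slab sA]] := edge_relabel hd.
apply: (@star_color_book s) => [f|v].
  by exists (hd f) => g /slab <-; rewrite hdP !inE eqxx orbT.
apply: leq_trans (sA (fun f => v \in val f)) _.
(* Edges into [v] share the label [v]; those with tail [v] add at most [k] labels. *)
apply: leq_trans (_ : #|v |: [set hd f | f in [set f | t f == v]]| <= _).
  apply/subset_leq_card/subsetP=> _ /imsetP[f + ->]; rewrite inE hdP !inE.
  case/orP=> [/eqP tv|/eqP->]; last by rewrite eqxx.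
  by apply/orP; right; apply/imsetP; exists f; rewrite ?inE ?tv.
apply: leq_trans (leq_card_setU _ _).1 _; rewrite cards1 ltnS.
exact: leq_trans (leq_imset_card _ _) (tk v).
Qed.

Lemma pn_local_le_mad : ((pn_local e)%:R <= mad e / 2%:R + 2%:R :> rat)%R.
Proof.
(* Rounding down gives [mad e < 2 * (k + 1)], so [local_book_of_mad] applies at [k.+1] and yields
   [k.+2]. *)
pose k := Num.trunc (mad e / 2%:R)%R.
have /andP[k1 k2] : (k%:R <= mad e / 2%:R < k.+1%:R)%R.
  by apply: truncn_itv; rewrite divr_ge0 ?mad_ge0.
have : pn_local e <= k.+2.
  rewrite /pn_local; case: ex_minnP => m _; apply; apply/asboolP.
  by apply: local_book_of_mad; rewrite natrM -ltr_pdivrMl // mulrC.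
by rewrite -(ler_nat rat) => /le_trans; apply; rewrite -addn2 natrD lerD2r.
Qed.

(** * The graphic matroid *)

Implicit Types A B : {set edge_t e}.

Definition adj (A : {set edge_t e}) : rel T :=
  fun x y => [exists a in A, val a == [set x; y]].

Lemma adj_sym A : connect_sym (adj A).
Proof.
apply: sym_connect_sym => x y; rewrite /adj.
by apply: eq_existsb => a; rewrite setUC.
Qed.

(** Closure in the graphic matroid. Ranging over all pairs of members avoids naming the two ends. *)
Definition graphic_span (A : {set edge_t e}) : pred (edge_t e) :=
  fun f => [forall x in val f, forall y in val f, connect (adj A) x y].

Lemma graphic_spanE A f x y : val f = [set x; y] ->
  graphic_span A f = connect (adj A) x y.
Proof.
move=> fxy; rewrite /graphic_span fxy; apply/idP/idP => [|H].
  by move/forall_inP/(_ x); rewrite !inE eqxx => /(_ isT)/forall_inP/(_ y);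
     rewrite !inE eqxx orbT => /(_ isT).
apply/forall_inP=> u; rewrite !inE => /orP[]/eqP->; apply/forall_inP=> v;
  by rewrite !inE => /orP[]/eqP->; rewrite ?connect0 // adj_sym.
Qed.

(** A walk using the edge [f] can be shortened to traverse it at most once, in one of two
    directions. *)
Lemma connect_adjU1 A f a b x y : val f = [set a; b] ->
  connect (adj (f |: A)) x y ->
  [\/ connect (adj A) x y,
      connect (adj A) x a /\ connect (adj A) b y |
      connect (adj A) x b /\ connect (adj A) a y].
Proof.
move=> fab /connectP[s + ->]; elim: s x => [|z s IHs] x /=.
  by constructor 1; apply: connect0.
case/andP=> /exists_inP[g gA /eqP gxz] /IHs IH.
have [fg|nfg] := eqVneq g f; last first.
  have xz : connect (adj A) x z.
    apply/connect1/exists_inP; exists g; rewrite ?gxz //.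
    by move: gA; rewrite !inE (negbTE nfg).
  case: IH => [zy|[za by_]|[zb ay]].
  - by constructor 1; apply: connect_trans zy.
  - by constructor 2; split=> //; apply: connect_trans za.
  - by constructor 3; split=> //; apply: connect_trans zb.
have : x \in val f by rewrite -fg gxz !inE eqxx.
have : z \in val f by rewrite -fg gxz !inE eqxx orbT.
have xz : x != z.
  have [u [v [uv guv]]] := edgeP g; apply: contraNneq uv => xz.
  move: guv; rewrite gxz xz setUid => /setP H.
  by have := H u; have := H v; rewrite !inE !eqxx orbT => /eqP-> /eqP->.
rewrite fab !inE => /orP[]/eqP zE /orP[]/eqP xE; subst x z; rewrite ?eqxx // in xz.
- by case: IH => [ay|[_ by_]|[_ ay]];
    [constructor 3 | constructor 1 | constructor 3]; rewrite ?connect0.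
- by case: IH => [by_|[_ by_]|[_ ay]];
    [constructor 2 | constructor 2 | constructor 1]; rewrite ?connect0.
Qed.

Lemma graphic_span_ext A f : f \in A -> graphic_span A f.
Proof.
move=> fA; have [u [v [_ fuv]]] := edgeP f; rewrite (graphic_spanE _ fuv).
by apply/connect1/exists_inP; exists f; rewrite ?fuv.
Qed.

Lemma graphic_span_connect A B x y :
  (forall a, a \in A -> graphic_span B a) ->
  connect (adj A) x y -> connect (adj B) x y.
Proof.
move=> AB; apply: connect_sub => u v /exists_inP[a /AB + /eqP auv].
by rewrite (graphic_spanE _ auv).
Qed.

(** The new connection between the ends of [f] must run through [g]. Closing it up with [f] and
    leaving out [g] joins the ends of [g]. *)
Lemma graphic_span_exch A f g :
  graphic_span (g |: A) f -> ~~ graphic_span A f -> graphic_span (f |: A) g.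
Proof.
have [x [y [_ fxy]]] := edgeP f; have [a [b [_ gab]]] := edgeP g.
rewrite !(graphic_spanE _ fxy) (graphic_spanE _ gab) => /(connect_adjU1 gab) xy nxy.
have up u v : connect (adj A) u v -> connect (adj (f |: A)) u v.
  by apply: graphic_span_connect => c cA; apply: graphic_span_ext; rewrite !inE cA orbT.
have fxy' : connect (adj (f |: A)) x y.
  by apply/connect1/exists_inP; exists f; rewrite ?setU11 // fxy.
case: xy => [xy|[xa by_]|[xb ay]]; first by rewrite xy in nxy.
  apply: connect_trans (connect_trans fxy' _); first by rewrite adj_sym up.
  by rewrite adj_sym up.
apply: connect_trans (up _ _ ay) _; rewrite adj_sym.
apply: connect_trans fxy'; first by rewrite adj_sym up.
Qed.

(** * Rooted forests and vertex orders *)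

(** Here [d] is the distance from [x], and [p v] precedes [v] on a shortest path. Minimality at both
    vertices gives the depth equation. *)
Lemma bfs_tree (R : rel T) (x : T) : exists (p : T -> T) (d : T -> nat),
  forall v, connect R x v ->
    v = x \/ [/\ R (p v) v, connect R x (p v) & d v = (d (p v)).+1].
Proof.
pose P v n := [exists s : n.-tuple T, path R x s && (last x s == v)].
have PP v n : reflect (exists s, [/\ path R x s, last x s = v & size s = n]) (P v n).
  apply: (iffP existsP) => [[s /andP[ps /eqP ls]]|[s [ps ls /eqP ss]]].
    by exists s; rewrite size_tuple.
  by exists (Tuple ss); rewrite /= ps ls eqxx.
have /choice[d dP] v : exists n, connect R x v -> P v n /\ forall m, P v m -> n <= m.
  case: (boolP (connect R x v)) => [|_]; last by exists 0.
  case/connectP=> s ps ls; have: exists n, P v n by exists (size s); apply/PP; exists s.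
  by case/ex_minnP=> n Pn mn; exists n.
have /choice[p pP] v : exists u, connect R x v ->
    v = x \/ [/\ R u v, connect R x u & d v = (d u).+1].
  case: (boolP (connect R x v)) => [cv|_]; last by exists v.
  have [/PP[s [ps ls ss]] dmin] := dP v cv.
  case/lastP: s => [|s w] in ps ls ss *; first by exists v; left; rewrite -ls.
  move: ps ls ss; rewrite rcons_path last_rcons size_rcons => /andP[ps Rw] wv ss; subst w.
  have cu : connect R x (last x s) by apply/connectP; exists s.
  have [/PP[s' [ps' ls' ss']] umin] := dP _ cu.
  exists (last x s) => _; right; split=> //; apply/eqP; rewrite eqn_leq; apply/andP; split.
    apply: dmin; apply/PP; exists (rcons s' v).
    by rewrite rcons_path last_rcons size_rcons ps' ls' ss'.
  by rewrite -ss ltnS; apply: umin; apply/PP; exists s.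
by exists p, d.
Qed.

(* Witnesses: breadth-first search from a root of each component.  By acyclicity
   every edge is a tree edge. *)
Lemma forest_parent A :
  (forall f, f \in A -> ~~ graphic_span (A :\ f) f) ->
  exists (p : T -> T) (d : T -> nat), forall f, f \in A ->
    exists v, val f = [set v; p v] /\ d v = (d (p v)).+1.
Proof.
move=> iA; have [q qP] := choice (bfs_tree (adj A)).
have [D DP] := choice qP.
pose rt := fingraph.root (adj A).
have rtv v : connect (adj A) (rt v) v by rewrite adj_sym connect_root.
pose p v := q (rt v) v; pose d v := D (rt v) v.
have tree v : v = rt v \/ [/\ adj A (p v) v, rt (p v) = rt v & d v = (d (p v)).+1].
  have [|[ap cp dp]] := DP _ _ (rtv v); [by left | right].
  have rp : rt (p v) = rt v by apply/eqP; rewrite root_connect ?connect1 //; apply: adj_sym.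
  by split=> //; rewrite /d rp.
exists p, d => f fA; apply: contrapT => nf.
have [x [y [_ fxy]]] := edgeP f; case/negP: (iA f fA); rewrite (graphic_spanE _ fxy).
(* If [f] is not a tree edge, the tree paths to the roots avoid it, so its ends stay connected in
   [A :\ f]. *)
have toroot v : connect (adj (A :\ f)) v (rt v).
  elim: {v}(d v) {-2}v (erefl (d v)) => [|n IHn] v dv.
    by case: (tree v) => [<-|[_ _]]; rewrite ?connect0 // dv.
  case: (tree v) => [<-|[/exists_inP[g gA /eqP gE] rp]]; first exact: connect0.
  rewrite dv => -[/esym dp]; rewrite -rp; apply: connect_trans (IHn _ dp).
  apply/connect1/exists_inP; exists g; last by rewrite gE setUC.
  rewrite !inE gA andbT; apply/eqP=> gf; apply: nf; exists v.
  by rewrite -gf gE setUC dv dp.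
have rxy : rt x = rt y.
  apply/eqP; rewrite root_connect; last exact: adj_sym.
  by apply/connect1/exists_inP; exists f; rewrite ?fxy.
by apply: connect_trans (toroot x) _; rewrite rxy adj_sym.
Qed.

(** Induction removing a vertex [x] of maximal depth in [A], which is the parent of no member.
    Doubling all positions frees the one right after [p x], and an edge between consecutive
    positions crosses nothing. *)
Lemma forest_order (p : T -> T) (d : T -> nat) (A : {set T}) :
  (forall v, v \in A -> d v = (d (p v)).+1) ->
  exists2 o : T -> nat, injective o &
    forall v w, v \in A -> w \in A -> ~ cross o [set v; p v] [set w; p w].
Proof.
move: {2}#|A| (erefl #|A|) => n; elim: n A => [|n IHn] A cA dA.
  exists (fun x => val (enum_rank x)); first by move=> x y /val_inj /enum_rank_inj.
  by move=> v w; rewrite (cards0_eq cA) inE.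
have [x0 x0A] : exists x, x \in A by apply/set0Pn; rewrite -card_gt0 cA.
have [x xA xmax] := arg_maxnP d x0A; have {}xA : x \in A := xA.
have [||o oinj oP] := IHn (A :\ x).
- by move: cA; rewrite (cardsD1 x) xA => -[].
- by move=> v; rewrite !inE => /andP[_ /dA].
have px v : v \in A -> p v != x.
  by move=> vA; apply/eqP=> pv; have := xmax v vA; rewrite /= (dA v vA) pv; lia.
(* the leaf [x] is inserted immediately after its parent *)
pose o' v := if v == x then (o (p x)).*2.+1 else (o v).*2.
have o'x : o' x = (o (p x)).*2.+1 by rewrite /o' eqxx.
have o'E v : v != x -> o' v = (o v).*2 by rewrite /o' => /negbTE->.
have o'px : o' (p x) = (o (p x)).*2 by rewrite o'E ?px.
exists o'.
  move=> u v; rewrite /o'; case: (eqVneq u x) => [->|_]; case: (eqVneq v x) => [->|_] //; try lia.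
  by move=> H; apply: oinj; lia.
have leaf (g : {set T}) : ~ cross o' [set x; p x] g /\ ~ cross o' g [set x; p x].
  split=> -[a [b [y [z [[]]]]]]; rewrite !inE.
    by move=> /orP[]/eqP-> /orP[]/eqP-> _ _; rewrite ?o'x ?o'px; lia.
  by move=> _ _ /orP[]/eqP-> /orP[]/eqP->; rewrite ?o'x ?o'px; lia.
move=> v w vA wA; have [->|vx] := eqVneq v x; first by case: (leaf [set w; p w]).
have [->|wx] := eqVneq w x; first by case: (leaf [set v; p v]).
have E u z : u \in A -> u != x -> z \in [set u; p u] -> o' z = (o z).*2.
  by move=> uA ux; rewrite !inE => /orP[]/eqP->; rewrite o'E ?px.
move=> [a [b [y [z [[ha hb hy hz]]]]]].
rewrite (E v a) // (E v b) // (E w y) // (E w z) // => H.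
case: (oP v w); rewrite ?inE ?vx ?wx //.
by exists a, b, y, z; split=> //; lia.
Qed.

(** * Partition into forests and union embeddings *)

Lemma card_edges_le (S : {set T}) (F : {set edge_t e}) :
  (forall f, f \in F -> val f \subset S) -> #|F| <= 'C(#|S|, 2).
Proof.
move=> FS; rewrite -cards_draws -(card_imset F val_inj).
apply/subset_leq_card/subsetP=> _ /imsetP[f fF ->].
rewrite inE FS //=; have [u [v [uv ->]]] := edgeP f.
by rewrite cards2 uv.
Qed.

(** In an obstruction, let [F] be the edges of [S] in the component [U] of the uncoloured edge [x].
    Every colour contains a spanning tree of [U], so with [x] there are more than
    [#|I| * (#|U| - 1)] edges in [F]. But [2 * #|F| <= (mad e + 1) * (#|U| - 1)]. *)
Lemma forest_partition (I : finType) :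
  (mad e + 1 < (2 * #|I|)%:R)%R ->
  exists c : edge_t e -> I, forall i f, c f = i ->
    ~~ graphic_span ([set g | c g == i] :\ f) f.
Proof.
move=> mI.
have [||| [c cI]|[c [S [x [xS cx cS]]]]] :=
  @matroid_partition _ I (fun=> graphic_span).
- by move=> _; apply: graphic_span_ext.
- move=> _ A B f AB; have [u [v [_ fuv]]] := edgeP f.
  by rewrite !(graphic_spanE _ fuv); apply: graphic_span_connect.
- by move=> _; apply: graphic_span_exch.
- by exists c => i f cf; apply: cI; rewrite inE cf.
have [r [r' [rr' xE]]] := edgeP x.
pose U := [set v | connect (adj S) r v].
pose F := [set f in S | val f \subset U].
have FU f : f \in F -> val f \subset U by rewrite inE => /andP[].
have rU : r \in U by rewrite inE connect0.
have adjU f u v : f \in S -> val f = [set u; v] -> u \in U -> f \in F.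
  move=> fS fuv; rewrite !inE fS /= => ru; rewrite fuv.
  apply/subsetP=> w; rewrite !inE => /orP[]/eqP-> //.
  by apply: connect_trans ru (connect1 _); apply/exists_inP; exists f; rewrite ?fuv.
have xF : x \in F by apply: adjU xS xE rU.
have [p pP] := choice (fun i => bfs_tree (adj (cls c i :&: S)) r).
have [d dP] := choice pP.
have Uconn i v : v \in U -> connect (adj (cls c i :&: S)) r v.
  by rewrite inE; apply: graphic_span_connect => a; apply: cS.
(* [pe (i, v)] is the edge from [v] to its parent in the tree of colour [i]; outside [U :\ r] the
   value [x] is a dummy. *)
have /choice[pe peP] (iv : I * T) : exists f, iv.2 \in U :\ r ->
    [/\ c f = Some iv.1, f \in F :\ x, val f = [set p iv.1 iv.2; iv.2] &
        d iv.1 iv.2 = (d iv.1 (p iv.1 iv.2)).+1].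
  case: iv => i v /=; case: (boolP (v \in U :\ r)) => [|_]; last by exists x.
  rewrite in_setD1 => /andP[vr vU].
  have [vE|[/exists_inP[f + /eqP fE] cp dv]] := dP _ _ (Uconn i v vU).
    by rewrite vE eqxx in vr.
  rewrite !inE => /andP[/eqP cf fS]; exists f => _; split=> //.
  rewrite in_setD1; apply/andP; split; first by apply/eqP=> fx; rewrite fx cx in cf.
  by apply: (adjU f v (p i v)); rewrite // fE setUC.
have cardF : #|I| * #|U :\ r| <= #|F :\ x|.
  rewrite -cardsT -cardsX.
  (* Two vertices with the same tree edge would be each other's parents, against the depths. *)
  have inj : {in setX [set: I] (U :\ r) &, injective pe}.
    move=> [i v] [j w]; rewrite !in_setX /= => /andP[_ vU] /andP[_ wU] E.
    have [cf _ vE dv] := peP (i, v) vU; have [cf' _ wE dw] := peP (j, w) wU.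
    have ij : i = j by move: cf'; rewrite -E cf /= => -[].
    subst j; congr pair; apply/eqP; apply: contraT => vw.
    have : v \in val (pe (i, w)) by rewrite -E vE !inE eqxx orbT.
    have : w \in val (pe (i, v)) by rewrite E wE !inE eqxx orbT.
    rewrite vE wE !inE eq_sym [w == v]eq_sym (negbTE vw) !orbF => /eqP wp /eqP vp.
    by move: vp wp dv dw => /= <- ->; lia.
  rewrite -(card_in_imset inj); apply/subset_leq_card/subsetP=> _ /imsetP[[i v] + ->].
  by rewrite in_setX => /andP[_ vU]; case: (peP (i, v) vU).
have H1 := card_edges_mad FU; have H2 := card_edges_le FU.
rewrite bin2 in H2.
have H3 : #|F| = #|F :\ x|.+1 by rewrite (cardsD1 x) xF.
have H4 : #|U| = #|U :\ r|.+1 by rewrite (cardsD1 r) rU.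
have H5 : 2 * #|F| <= #|U| * #|U|.-1 by lia.
have H6 : ((2 * #|F|)%:R <= #|U|%:R * #|U :\ r|%:R :> rat)%R.
  by rewrite -natrM ler_nat H4 /= in H5 *.
(* Split [2|F||U|] as [2|F|(|U| - 1) + 2|F|]: the first term is bounded through [mad e], the second
   by [|U|(|U| - 1)], as the graph is simple. *)
have H7 : ((2 * #|F|)%:R * #|U|%:R <= (mad e + 1) * #|U :\ r|%:R * #|U|%:R)%R.
  have H8 := ler_wpM2r (ler0n rat #|U :\ r|) H1.
  have H9 : (#|U|%:R = #|U :\ r|%:R + 1 :> rat)%R by rewrite H4 -natr1.
  rewrite {1}H9; lra.
have H8 : ((2 * #|F|)%:R <= (mad e + 1) * #|U :\ r|%:R)%R.
  by move: H7; rewrite ler_pM2r // ltr0n H4.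
have H9 : ((2 * #|F|)%:R <= (2 * #|I|)%:R * #|U :\ r|%:R :> rat)%R.
  by apply: le_trans H8 _; apply: ler_wpM2r; rewrite ?ler0n // ltW.
by move: H9; rewrite -natrM ler_nat; lia.
Qed.

Lemma union_embeddable_card (L : finType) o (p : edge_t e -> L) :
  union_embedding o p -> union_embeddable e #|L|.
Proof.
move=> [oi up]; exists o, (fun f => enum_rank (p f)); split=> // f g.
case=> /enum_rank_inj pfg [u [x [uf xg ux]]]; apply: up; split=> //.
exists u, x; split=> //; apply: connect_sub ux => a b /existsP[h /andP[/eqP/enum_rank_inj ph hE]].
by apply/connect1/existsP; exists h; rewrite ph eqxx.
Qed.

(** [None] indexes the forest that [forest_order] frees of crossings; it takes one page. Every other
    forest is split by the parity of the depth of the child end [t f], which leaves stars centred at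
    parents. *)
Lemma union_embeddable_of_mad k : (mad e + 1 < (2 * k.+1)%:R)%R ->
  union_embeddable e (k * 2).+1.
Proof.
move=> mk; have [|c cP] := @forest_partition (option 'I_k).
  by rewrite card_option card_ord.
have [p pP] := choice (fun i => forest_parent
  (fun f fi => cP i f (eqP (etrans (esym (in_set _ f)) fi)))).
have [d dP] := choice pP.
have /choice[t tP] f : exists v, val f = [set v; p (c f) v] /\
    d (c f) v = (d (c f) (p (c f) v)).+1.
  by apply: dP; rewrite inE.
have [|o oinj oP] := @forest_order (p None) (d None)
   [set v | d None v == (d None (p None v)).+1].
  by move=> v; rewrite inE => /eqP.
pose page f : option ('I_k * bool) :=
  if c f is Some i then Some (i, odd (d (c f) (t f))) else None.
have <- : #|{: option ('I_k * bool)}| = (k * 2).+1.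
  by rewrite card_option card_prod card_ord card_bool.
apply: (@union_embeddable_card _ o page); split=> // f g [pfg [u [x [uf xg ux]]]].
have [fE fd] := tP f; have [gE gd] := tP g.
move: pfg ux; rewrite {1 2}/page; case cf: (c f) => [i|]; case cg: (c g) => [j|] //.
  case=> ij par ux; subst j.
  (* [head v] is the centre of the star through [v]: its parent if [v] has the depth parity of the
     children on this page, else [v] itself. It is constant along the edges of the page, so [f] and
     [g] share it. *)
  pose head v := if odd (d (Some i) v) == odd (d (Some i) (t f)) then p (Some i) v else v.
  have headP h z : page h = page f -> z \in val h -> head z = p (c h) (t h).
    have [hE hd] := tP h.
    rewrite /page cf; case ch: (c h) hE hd => [j|] // hE hd [ij odh]; subst j.
    rewrite hE !inE /head => /orP[]/eqP->; first by rewrite odh eqxx.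
    by rewrite -odh hd /=; case: (odd _).
  have pg : page g = page f by rewrite /page cf cg par.
  have hux : head u = head x.
    have/connectP[s + ->] := ux; elim: s u {uf ux} => //= z s IHs u /andP[uz /IHs <-].
    case/existsP: uz => h /andP[/eqP ph /eqP hE].
    by rewrite !(headP h) // hE !inE eqxx ?orbT.
  apply: (@common_vertex_not_cross _ _ _ (p (Some i) (t f))).
    by rewrite fE !inE cf eqxx orbT.
  by rewrite -cf -(headP f u) // hux (headP g x) // gE !inE eqxx orbT.
by move=> _ _; rewrite cf in fE fd; rewrite cg in gE gd; rewrite fE gE; apply: oP; rewrite inE; apply/eqP.
Qed.

Lemma pn_union_le_mad : ((pn_union e)%:R <= mad e + 2%:R :> rat)%R.
Proof.
(* The forests need [mad e + 1 < 2 * (k + 1)], and [2 * k <= mad e + 1] bounds the [2 * k + 1]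
   pages. *)
pose k := Num.trunc ((mad e + 1) / 2%:R)%R.
have /andP[k1 k2] : (k%:R <= (mad e + 1) / 2%:R < k.+1%:R)%R.
  by apply: truncn_itv; rewrite divr_ge0 ?addr_ge0 ?mad_ge0.
have : pn_union e <= (k * 2).+1.
  rewrite /pn_union; case: ex_minnP => m _; apply; apply/asboolP.
  by apply: union_embeddable_of_mad; rewrite natrM -ltr_pdivrMl // mulrC.
rewrite -(ler_nat rat) => /le_trans; apply.
have -> : ((k * 2).+1%:R = k%:R * 2%:R + 1 :> rat)%R by rewrite -natr1 natrM.
by move: k1; rewrite ler_pdivlMr //; lra.
Qed.

End Graph.

Theorem theorem5 (T : finType) (e : rel T)
  (e_sym : symmetric e) (e_irr : irreflexive e) :
  pn_local e <= local_star_arboricity e /\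
  pn_union e <= star_arboricity e /\
  (mad e / 4%:R <= (pn_local e)%:R :> rat)%R /\
  ((pn_local e)%:R <= mad e / 2%:R + 2%:R :> rat)%R /\
  (mad e / 4%:R <= (pn_union e)%:R :> rat)%R /\
  ((pn_union e)%:R <= mad e + 2%:R :> rat)%R.
Proof.
split; first exact: pn_local_le_sa.
split; first exact: pn_union_le_sa.
rewrite !ler_pdivrMr // -!natrM ![_ * 4]mulnC.
split; first exact: mad_le_pn_local.
split; first exact: pn_local_le_mad.
split; first exact: mad_le_pn_union.
exact: pn_union_le_mad.
Qed.
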